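(* Let $\mu,\nu,a,b\in\mathbb{C}$ with $a\neq0$, $b\neq0$, $\operatorname{Re}\mu>0$, $\operatorname{Re}\nu>0$ and $\nu b^2\neq\mu a^2$, and set $$\delta=\frac{(b^2-a^2)\mu\nu}{\nu b^2-\mu a^2}.$$ Let $P_n(x)=c_0x^n+c_1x^{n-1}+\cdots+c_n$ be a polynomial with complex coefficients and $c_0\neq0$. Assume $a^k\neq b^k$ for all $1\le k\le n$. Then the following are equivalent: (a) $P_n$ is obtained from the recursion $P_k(x)=2xP_{k-1}(x)-\frac{1}{\delta}P_{k-1}'(x)$, $1\le k\le n$, starting from some nonzero constant $P_0(x)=C$. (b) There is a constant $C_n$ such that for all $z\in\mathbb{C}$ $$\int_{\mathbb{R}}P_n(x)e^{-\mu(x-az)^2}\,dx=C_n\int_{\mathbb{R}}P_n(x)e^{-\nu(x-bz)^2}\,dx.$$ (c) $c_{2k+1}=0$ whenever $2k+1\le n$, and $(n-2k)!\,c_{2k}=-2\delta(2k+2)(n-2k-2)!\,c_{2k+2}$ whenever $2k+2\le n$. Moreover, in these cases $C_n=\frac{\sqrt{\nu}}{\sqrt{\mu}}\left(\frac{a}{b}\right)^n$ and $$P_n(x)=C\sum_{k=0}^{\lfloor n/2\rfloor}\frac{(-1)^k2^nn!}{4^kk!\,(n-2k)!\,\delta^k}x^{n-2k},\qquad C=c_02^{-n}\neq0.$$ In particular, when $\delta=1$ the conditions are equivalent to $P_n$ being a nonzero constant multiple of the Hermite polynomial $H_n(x)=(-1)^ne^{x^2}\frac{d^n}{dx^n}e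^{-x^2}$.
   Context: Square roots are principal: $\sqrt{z}=\sqrt{|z|}e^{i\theta/2}$, $z=|z|e^{i\theta}$, $\theta\in(-\pi,\pi]$. $\lfloor\cdot\rfloor$ is the greatest integer function. *)

(* Defs.v *)
From HB Require Import structures.
From mathcomp Require Import all_boot all_order all_algebra.
From mathcomp Require Import all_classical all_reals all_analysis.
From mathcomp Require Import complex.
Set Implicit Arguments. Unset Strict Implicit. Unset Printing Implicit Defensive.
Import Order.TTheory GRing.Theory Num.Theory.
Local Open Scope ring_scope.
Local Open Scope complex_scope.

Section Defs.
Variable R : realType.

Definition Cexp (w : R[i]) : R[i] :=
  (expR (complex.Re w) * cos (complex.Im w)) +i* (expR (complex.Re w) * sin (complex.Im w)).

Definition Cint (f : R -> R[i]) : R[i] :=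
  (Rintegral lebesgue_measure setT (fun x => complex.Re (f x)))
  +i* (Rintegral lebesgue_measure setT (fun x => complex.Im (f x))).

Fixpoint herm_rec (delta C : R[i]) (k : nat) : {poly R[i]} :=
  match k with
  | 0 => C%:P
  | k'.+1 => 2%:R *: ('X * herm_rec delta C k')
             - delta^-1 *: (herm_rec delta C k')^`()
  end.

Definition hermiteH (n : nat) (x : R) : R :=
  (-1) ^+ n * expR (x ^+ 2) * derive1n n (fun t : R => expR (- t ^+ 2)) x.

End Defs.

(* Main.v *)
Require Import Defs.
From HB Require Import structures.
From mathcomp Require Import all_boot all_order all_algebra.
From mathcomp Require Import all_classical all_reals all_analysis.
From mathcomp Require Import complex.
From mathcomp Require Import measurable_realfun zify ring lra.
Set Implicit Arguments.
Unset Strict Implicit.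
Unset Printing Implicit Defensive.
Import Order.TTheory GRing.Theory Num.Theory.
Import numFieldNormedType.Exports.
Local Open Scope ring_scope.
Local Open Scope complex_scope.

(** Let [J] denote integration against [exp (- mu (x - w)^2)].  Integrating an
    exact derivative gives [J (X P) = w J P + J P' / (2 mu)], hence
    [J P = J 1 * (exp (D^2 / (4 mu)) P) (w)] with [D] differentiation, and
    [J 1 = sqrt (pi / mu)] by a deformation of the contour.  So (b) says that
    [exp (D^2 / (4 mu)) P] at [a z] and [exp (D^2 / (4 nu)) P] at [b z] are
    proportional.  Leading coefficients force the factor [(a / b)^n], and, as
    [a^k != b^k], a solution of degree [n] is unique up to a scalar.  A solution
    is [exp (k D^2) X^n] when [(k + 1/(4 mu)) / a^2 = (k + 1/(4 nu)) / b^2],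
    that is [k = -1/(4 delta)]; (a) and (c) describe the same polynomial. *)

(** [Cint] is a pair of real Lebesgue integrals over the line, so there is no contour integral to
    deform. Its substitute is differentiation under the integral sign along a family of complex
    affine contours, which asks for Gaussian bounds uniform in the parameter; this shapes the
    calculus of [gauss_decay]. The exponent [1 / (4 mu)] comes from the rule [exp (al D^2) X = (X +
    2 al D) exp (al D^2)]: comparison with the recursion for [J] gives [2 al = 1 / (2 mu)]. The
    conditions (a), (b) and (c) are not compared with one another directly: each is shown equivalent
    to [P] being its leading coefficient times one monic polynomial, [exp (k D^2) X^n]. *)

Notation normc := ComplexField.Normc.normc.

(** * Derivatives of complex-valued functions of a real variable *)

Section ComplexCalculus.
Variable R : realType.
Implicit Types (f g : R -> R[i]) (x y : R) (z w : R[i]).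

(** Componentwise, to match [Cint]: facts on [R[i]]-valued functions then come from real
    analysis. *)
Definition cderive f f' := forall x,
  is_derive x 1 (fun y => complex.Re (f y)) (complex.Re (f' x)) /\
  is_derive x 1 (fun y => complex.Im (f y)) (complex.Im (f' x)).

Lemma ReM z w : complex.Re (z * w) =
  complex.Re z * complex.Re w - complex.Im z * complex.Im w.
Proof. by case: z; case: w. Qed.

Lemma ImM z w : complex.Im (z * w) =
  complex.Re z * complex.Im w + complex.Im z * complex.Re w.
Proof. by case: z; case: w. Qed.

Lemma ReD z w : complex.Re (z + w) = complex.Re z + complex.Re w.
Proof. by case: z; case: w. Qed.

Lemma ImD z w : complex.Im (z + w) = complex.Im z + complex.Im w.
Proof. by case: z; case: w. Qed.

Lemma ReN z : complex.Re (- z) = - complex.Re z.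
Proof. by case: z. Qed.

Lemma ImN z : complex.Im (- z) = - complex.Im z.
Proof. by case: z. Qed.

Lemma ReMreal z x : complex.Re (z * x%:C) = complex.Re z * x.
Proof. by case: z => a b /=; rewrite mulr0 subr0. Qed.

Lemma ImMreal z x : complex.Im (z * x%:C) = complex.Im z * x.
Proof. by case: z => a b /=; rewrite mulr0 add0r. Qed.

Lemma complex_ext z w :
  complex.Re z = complex.Re w -> complex.Im z = complex.Im w -> z = w.
Proof. by case: z => a b; case: w => c d /= -> ->. Qed.

Lemma cderive_eq f f' g g' :
  cderive f f' -> f =1 g -> f' =1 g' -> cderive g g'.
Proof. by move=> df /funext <- /funext <-. Qed.

Lemma cderive_cst z : cderive (fun=> z) (fun=> 0).
Proof. by move=> x; split; exact: is_derive_cst. Qed.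

Lemma cderive_real (h h' : R -> R) :
  (forall x, is_derive x 1 h (h' x)) ->
  cderive (fun x => (h x)%:C) (fun x => (h' x)%:C).
Proof. by move=> dh x; split=> //=; exact: is_derive_cst. Qed.

Lemma cderive_id : cderive (fun x => x%:C) (fun=> 1).
Proof. by apply: (@cderive_real id (fun=> 1)) => x; exact: is_derive_id. Qed.

Lemma cderiveD f g f' g' : cderive f f' -> cderive g g' ->
  cderive (fun x => f x + g x) (fun x => f' x + g' x).
Proof.
move=> df dg x; have [? ?] := df x; have [? ?] := dg x; split.
- under eq_fun do rewrite ReD; rewrite ReD; exact: is_deriveD.
- under eq_fun do rewrite ImD; rewrite ImD; exact: is_deriveD.
Qed.

Lemma cderiveN f f' : cderive f f' -> cderive (fun x => - f x) (fun x => - f' x).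
Proof.
move=> df x; have [? ?] := df x; split.
- under eq_fun do rewrite ReN; rewrite ReN; exact: is_deriveN.
- under eq_fun do rewrite ImN; rewrite ImN; exact: is_deriveN.
Qed.

Lemma cderiveM f g f' g' : cderive f f' -> cderive g g' ->
  cderive (fun x => f x * g x) (fun x => f' x * g x + f x * g' x).
Proof.
move=> df dg x; have [? ?] := df x; have [? ?] := dg x; split.
- under eq_fun do rewrite ReM; apply: is_derive_eq.
  by rewrite ReD !ReM /GRing.scale /=; ring.
- under eq_fun do rewrite ImM; apply: is_derive_eq.
  by rewrite ImD !ImM /GRing.scale /=; ring.
Qed.

Lemma cderive_Cexp f f' : cderive f f' ->
  cderive (fun x => Cexp (f x)) (fun x => f' x * Cexp (f x)).
Proof.
move=> df x; have [dr di] := df x.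
have de := @is_derive1_comp _ expR _ _ _ _ (is_derive_expR _) dr.
have dc := @is_derive1_comp _ cos _ _ _ _ (is_derive_cos _) di.
have ds := @is_derive1_comp _ sin _ _ _ _ (is_derive_sin _) di.
have dec := is_deriveM de dc; have des := is_deriveM de ds.
split; [apply: (is_derive_eq dec)|apply: (is_derive_eq des)];
  by rewrite ?ReM ?ImM /Cexp /= /GRing.scale /=; ring.
Qed.

Lemma cderive_horner (P : {poly R[i]}) :
  cderive (fun x => P.[x%:C]) (fun x => P^`().[x%:C]).
Proof.
elim/poly_ind: P => [|P z IH].
  by apply: cderive_eq (cderive_cst 0) _ _ => x; rewrite ?deriv0 horner0.
apply: cderive_eq (cderiveD (cderiveM IH cderive_id) (cderive_cst z)) _ _ => x.
  by rewrite hornerMXaddC.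
by rewrite derivMXaddC hornerD hornerMX /=; ring.
Qed.

End ComplexCalculus.

(** * Functions bounded by a Gaussian, uniformly in a parameter *)

Section GaussianDecay.
Variable R : realType.
Implicit Types (x y : R) (z w : R[i]).

Lemma normcE z : normc z = Num.sqrt (complex.Re z ^+ 2 + complex.Im z ^+ 2).
Proof. by case: z. Qed.

Lemma normc_ge0 z : 0 <= normc z.
Proof. by rewrite normcE sqrtr_ge0. Qed.

Lemma normr_Re_le z : `|complex.Re z| <= normc z.
Proof. by rewrite normcE -sqrtr_sqr ler_wsqrtr// lerDl sqr_ge0. Qed.

Lemma normr_Im_le z : `|complex.Im z| <= normc z.
Proof. by rewrite normcE -sqrtr_sqr ler_wsqrtr// lerDr sqr_ge0. Qed.

Lemma normc_real x : normc x%:C = `|x|.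
Proof. by rewrite normcE /= expr0n addr0 sqrtr_sqr. Qed.

Lemma normc_Cexp w : normc (Cexp w) = expR (complex.Re w).
Proof.
rewrite normcE /= !exprMn -mulrDr cos2Dsin2 mulr1 sqrtr_sqr.
by rewrite ger0_norm// expR_ge0.
Qed.

Variables (T : Type) (D : T -> Prop).
Implicit Types (f g : T -> R -> R[i]).

(** [K] and [c] do not depend on [t], as dominated differentiation requires; a single function is
    the case where [T] is [unit]. *)
Definition gauss_decay f := exists K c : R,
  [/\ 0 <= K, 0 < c & forall t x, D t -> normc (f t x) <= K * expR (- c * x ^+ 2)].

Lemma gauss_decay_eq f g : gauss_decay f -> (forall t, f t =1 g t) ->
  gauss_decay g.
Proof.
by move=> [K [c [K0 c0 Kc]]] fg; exists K, c; split=> // t x; rewrite -fg; exact: Kc.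
Qed.

Lemma gauss_decayD f g : gauss_decay f -> gauss_decay g ->
  gauss_decay (fun t x => f t x + g t x).
Proof.
move=> [K [c [K0 c0 Kc]]] [L [d [L0 d0 Ld]]].
exists (K + L), (Num.min c d); split.
- exact: addr_ge0.
- by rewrite lt_min c0.
move=> t x Dt; apply: le_trans (le_normcD _ _) _.
rewrite mulrDl lerD//.
- apply: le_trans (Kc _ _ Dt) _; rewrite ler_wpM2l// ler_expR ler_wpM2r ?sqr_ge0//.
  by rewrite lerN2 ge_min lexx.
- apply: le_trans (Ld _ _ Dt) _; rewrite ler_wpM2l// ler_expR ler_wpM2r ?sqr_ge0//.
  by rewrite lerN2 ge_min lexx orbT.
Qed.

Lemma gauss_decayM_bounded (b : T -> R[i]) (M : R) f :
  (forall t, D t -> normc (b t) <= M) -> gauss_decay f ->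
  gauss_decay (fun t x => b t * f t x).
Proof.
move=> bM [K [c [K0 c0 Kc]]].
exists (Num.max M 0 * K), c; split=> //.
  by rewrite mulr_ge0// le_max lexx orbT.
move=> t x Dt; rewrite ComplexField.Normc.normcM -mulrA.
apply: ler_pM; rewrite ?normc_ge0//; last exact: Kc.
by rewrite le_max bM.
Qed.

Lemma gauss_decayMl z f : gauss_decay f -> gauss_decay (fun t x => z * f t x).
Proof. exact: (@gauss_decayM_bounded (fun=> z) (normc z)). Qed.

(** Half of the exponent pays for the factor: [|x| <= 1 + x^2 <= (1 + 2/c) (1 + c x^2 / 2) <= (1 +
    2/c) exp (c x^2 / 2)]. *)
Lemma gauss_decayMx f : gauss_decay f -> gauss_decay (fun t x => x%:C * f t x).
Proof.
move=> [K [c [K0 c0 Kc]]].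
exists ((1 + 2 / c) * K), (c / 2); split.
- by rewrite mulr_ge0// addr_ge0// divr_ge0// ltW.
- by rewrite divr_gt0.
move=> t x Dt; rewrite ComplexField.Normc.normcM normc_real.
apply: (@le_trans _ _ (`|x| * (K * expR (- c * x ^+ 2)))).
  by rewrite ler_wpM2l ?Kc.
rewrite (_ : - c * x ^+ 2 = - (c / 2) * x ^+ 2 + - (c / 2) * x ^+ 2); last first.
  by field.
rewrite expRD mulrCA mulrA -[X in _ <= X * _]mulrC -!mulrA ler_wpM2l//.
rewrite mulrA ler_wpM2r ?expR_ge0//.
have h : 0 <= c / 2 * x ^+ 2 by rewrite mulr_ge0 ?sqr_ge0// divr_ge0// ltW.
rewrite mulNr expRN ler_pdivrMr ?expR_gt0//.
apply: (@le_trans _ _ ((1 + 2 / c) * (1 + c / 2 * x ^+ 2))); last first.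
  by rewrite ler_wpM2l ?expR_ge1Dx// addr_ge0// divr_ge0// ltW.
have -> : (1 + 2 / c) * (1 + c / 2 * x ^+ 2) = 1 + x ^+ 2 + (2 / c + c / 2 * x ^+ 2).
  by field; rewrite gt_eqF.
have : 0 <= 2 / c by rewrite divr_ge0// ltW.
have : `|x| <= 1 + x ^+ 2.
  by rewrite -(real_normK (num_real x)); have := sqr_ge0 (`|x| - 1); nra.
lra.
Qed.

Lemma gauss_decay_horner (P : {poly R[i]}) f : gauss_decay f ->
  gauss_decay (fun t x => P.[x%:C] * f t x).
Proof.
move=> df; elim/poly_ind: P => [|P z IH].
  by apply: gauss_decay_eq (gauss_decayMl 0 df) _ => t x; rewrite horner0.
apply: gauss_decay_eq (gauss_decayD (gauss_decayMx IH) (gauss_decayMl z df)) _.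
by move=> t x; rewrite hornerMXaddC; ring.
Qed.

(** Completing the square gives [W |x| - m x^2 / 2 <= W^2 / (2 m)]; the other half of the quadratic
    term is the decay. *)
Lemma gauss_decay_Cexp (q : T -> R -> R[i]) (m V W : R) : 0 < m ->
  (forall t x, D t -> complex.Re (q t x) <= V + W * `|x| - m * x ^+ 2) ->
  gauss_decay (fun t x => Cexp (q t x)).
Proof.
move=> m0 qle; exists (expR (V + W ^+ 2 / (2 * m))), (m / 2); split.
- exact: expR_ge0.
- by rewrite divr_gt0.
move=> t x Dt; rewrite normc_Cexp -expRD ler_expR.
apply: le_trans (qle _ _ Dt) _; rewrite -(real_normK (num_real x)) -subr_ge0.
have -> : V + W ^+ 2 / (2 * m) + - (m / 2) * `|x| ^+ 2 -
  (V + W * `|x| - m * `|x| ^+ 2) = (m * `|x| - W) ^+ 2 / (2 * m).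
  by field; rewrite gt_eqF.
by rewrite divr_ge0 ?sqr_ge0// mulr_ge0// ltW.
Qed.

End GaussianDecay.

(** * Real integrals under a Gaussian bound *)

Section GaussianIntegration.
Variable R : realType.
Implicit Types (x y : R) (z w : R[i]).
Local Notation leb := (@lebesgue_measure R).
Local Open Scope classical_set_scope.

Lemma integrable_expR_sqr (c : R) : 0 < c ->
  leb.-integrable setT (EFin \o (fun x => expR (- c * x ^+ 2))).
Proof.
(* The normal density of variance [1 / (2 c)] is [exp (- c x^2)] times its peak value. *)
move=> c0; pose s := Num.sqrt (c^-1 / 2).
have c0' : 0 < c^-1 / 2 by rewrite divr_gt0// invr_gt0.
have s0 : s != 0 by rewrite gt_eqF// sqrtr_gt0.
have sE : s ^+ 2 = c^-1 / 2 by rewrite sqr_sqrtr// ltW.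
have p0 : normal_peak s != 0 by rewrite gt_eqF// normal_peak_gt0.
have -> : EFin \o (fun x => expR (- c * x ^+ 2)) =
    (fun x => ((normal_peak s)^-1)%:E * (normal_pdf 0 s x)%:E)%E.
  apply/funext => x /=; rewrite -EFinM normal_pdfE// mulKf// /normal_fun.
  congr (expR _)%:E; rewrite subr0 sE -mulr_natr; field.
  by rewrite gt_eqF.
by apply: integrableZl => //; exact: integrable_normal_pdf.
Qed.

Lemma integrable_gauss (K c : R) : 0 < c ->
  leb.-integrable setT (EFin \o (fun x => K * expR (- c * x ^+ 2))).
Proof.
move=> c0; have -> : EFin \o (fun x => K * expR (- c * x ^+ 2)) =
  (fun x => K%:E * (EFin \o (fun x => expR (- c * x ^+ 2)%R)) x)%E.
  by apply/funext => x /=; rewrite EFinM.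
by apply: integrableZl => //; exact: integrable_expR_sqr.
Qed.

Lemma le_integrable_gauss (f : R -> R) (K c : R) : 0 < c -> continuous f ->
  (forall x, `|f x| <= K * expR (- c * x ^+ 2)) ->
  leb.-integrable setT (EFin \o f).
Proof.
move=> c0 cf fK.
apply: (@le_integrable _ _ _ leb setT measurableT _ (EFin \o (fun x => K * expR (- c * x ^+ 2)))) => //.
- by apply/measurable_EFinP; exact: continuous_measurable_fun.
- move=> x _ /=; rewrite lee_fin; apply: le_trans (fK x) _; exact: ler_norm.
- exact: integrable_gauss.
Qed.

(** [exp (c u^2) >= 1 + c u^2 >= c (n + 1)] when [|u| = n + 1]. The absolute value covers both ends
    of a growing interval. *)
Lemma cvg_gauss_harmonic (f : R -> R) (K c : R) (u : nat -> R) : 0 < c ->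
  (forall x, `|f x| <= K * expR (- c * x ^+ 2)) ->
  (forall n, `|u n| = n.+1%:R) ->
  (fun n => f (u n)) @ \oo --> (0 : R).
Proof.
move=> c0 fK uE; apply: norm_cvg0.
have K0 : 0 <= K.
  by have := le_trans (normr_ge0 _) (fK 0); rewrite expr0n mulr0 expR0 mulr1.
apply: (@squeeze_cvgr _ _ _ _ (cst 0) (fun n => K / c * harmonic n)).
- apply: nearW => n /=; rewrite normr_ge0/=; apply: le_trans (fK _) _.
  rewrite -mulrA ler_wpM2l// mulNr expRN -invfM lef_pV2 ?posrE ?expR_gt0 ?mulr_gt0//.
  apply: le_trans (expR_ge1Dx _).
  rewrite -(real_normK (num_real (u n))) uE.
  have : 1 <= n.+1%:R :> R by rewrite ler1n.
  by move: c0; nra.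
- exact: cvg_cst.
- rewrite -[X in _ --> X](mulr0 (K / c)); apply: cvgMl_tmp.
  exact: cvg_harmonic.
Qed.

(** By the fundamental theorem of calculus on growing intervals: the boundary values tend to 0, and
    dominated convergence passes to the whole line. *)
Lemma Rintegral_derive_eq0 (f f' : R -> R) (K c : R) : 0 < c ->
  (forall x, is_derive x 1 f (f' x)) -> continuous f' ->
  (forall x, `|f x| <= K * expR (- c * x ^+ 2)) ->
  (forall x, `|f' x| <= K * expR (- c * x ^+ 2)) ->
  Rintegral leb setT f' = 0.
Proof.
move=> c0 df cf' fK f'K.
have cf : continuous f.
  by move=> x; apply: differentiable_continuous; apply/derivable1_diffP; case: (df x).
(* [n.+1] keeps the interval nondegenerate at [n = 0]. *)
pose I n : set R := `[- n.+1%:R, n.+1%:R].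
pose F n := EFin \o (f' \_ (I n)).
have FE n : (\int[leb]_(x in setT) F n x = (f n.+1%:R - f (- n.+1%:R))%:E)%E.
  rewrite /F -restrict_EFin -integral_mkcond EFinB.
  apply: continuous_FTC2.
  - by rewrite gtrN// ltr0n.
  - by apply: continuous_subspaceT.
  - split.
    + by move=> x _; case: (df x).
    + exact/cvg_at_right_filter/cf.
    + exact/cvg_at_left_filter/cf.
  - by move=> x _; rewrite derive1E; case: (df x).
have F0 : (\int[leb]_(x in setT) F n x)%E @[n --> \oo] --> 0%E.
  under eq_cvg do rewrite FE.
  apply: cvg_EFin; first exact: nearW.
  rewrite -[X in _ --> X](subrr 0); apply: cvgB.
  - apply: (@cvg_gauss_harmonic f K c (fun n => n.+1%:R)) => // n.
    by rewrite ger0_norm.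
  - apply: (@cvg_gauss_harmonic f K c (fun n => - n.+1%:R)) => // n.
    by rewrite normrN ger0_norm.
have mf' : measurable_fun setT f' by exact: continuous_measurable_fun.
have F1 : (\int[leb]_(x in setT) F n x)%E @[n --> \oo] -->
    (\int[leb]_(x in setT) (f' x)%:E)%E.
  apply: (@dominated_cvg _ _ _ leb setT measurableT F (EFin \o f')
    (EFin \o (fun x => K * expR (- c * x ^+ 2)))) => //.
  - move=> n; apply/measurable_EFinP.
    have mI : measurable (I n) by exact: measurable_itv.
    by apply: (measurable_restrictT _ mI).1; exact: measurable_funTS.
  - move=> x _; apply: cvg_near_cst.
    (* From this rank on the interval contains [x]. *)
    exists (Num.truncn `|x|) => // n /= xn; congr EFin.
    rewrite patchE ifT// inE /I /= in_itv /= -ler_norml.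
    apply: ltW; apply: lt_le_trans (truncnS_gt _) _.
    by rewrite ler_nat ltnS.
  - exact: integrable_gauss.
  - move=> n x _ /=; rewrite lee_fin patchE; case: ifP => // _.
    by rewrite normr0; apply: le_trans (normr_ge0 _) (f'K x).
by rewrite /Rintegral (cvg_unique _ F1 F0).
Qed.

End GaussianIntegration.

(** * The complex integral *)

Section ComplexIntegral.
Variable R : realType.
Implicit Types (f g : R -> R[i]) (x y : R) (z w : R[i]).
Local Notation leb := (@lebesgue_measure R).

Definition cintegrable f :=
  leb.-integrable setT (EFin \o (fun x => complex.Re (f x))) /\
  leb.-integrable setT (EFin \o (fun x => complex.Im (f x))).

Local Notation gauss_decay1 f := (gauss_decay (fun _ : unit => True) (fun=> f)).

Lemma eq_Cint f g : f =1 g -> Cint f = Cint g.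
Proof. by move=> /funext ->. Qed.

Lemma CintD f g : cintegrable f -> cintegrable g ->
  Cint (fun x => f x + g x) = Cint f + Cint g.
Proof.
move=> [fr fi] [gr gi]; apply: complex_ext => /=.
- by under eq_Rintegral do rewrite ReD; rewrite RintegralD.
- by under eq_Rintegral do rewrite ImD; rewrite RintegralD.
Qed.

Lemma integrable_lincomb (u v : R -> R) (k l : R) :
  leb.-integrable setT (EFin \o u) -> leb.-integrable setT (EFin \o v) ->
  leb.-integrable setT (EFin \o (fun x => k * u x + l * v x)) /\
  Rintegral leb setT (fun x => k * u x + l * v x) =
    k * Rintegral leb setT u + l * Rintegral leb setT v.
Proof.
move=> iu iv.
have ik (h : R -> R) (j : R) : leb.-integrable setT (EFin \o h) ->
    leb.-integrable setT (EFin \o (fun x => j * h x)).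
  move=> ih; have -> : EFin \o (fun x => j * h x) =
      (fun x => j%:E * (EFin \o h) x)%E by apply/funext => x /=; rewrite EFinM.
  exact: integrableZl.
split.
- have -> : EFin \o (fun x => k * u x + l * v x) =
    ((EFin \o (fun x => k * u x)%R) \+ (EFin \o (fun x => l * v x)%R))%E.
    by apply/funext => x /=; rewrite EFinD.
  by apply: integrableD => //; exact: ik.
- by rewrite RintegralD ?RintegralZl//; exact: ik.
Qed.

Lemma CintZl z f : cintegrable f -> Cint (fun x => z * f x) = z * Cint f.
Proof.
move=> [fr fi]; apply: complex_ext => /=.
- under eq_Rintegral do rewrite ReM -mulNr.
  by rewrite (integrable_lincomb _ _ fr fi).2 ReM mulNr.
- under eq_Rintegral do rewrite ImM.
  by rewrite (integrable_lincomb _ _ fi fr).2 ImM.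
Qed.

Lemma continuous_cderive f f' : cderive f f' ->
  continuous (fun x => complex.Re (f x)) /\ continuous (fun x => complex.Im (f x)).
Proof.
move=> df; split=> x; have [d1 d2] := df x; apply: differentiable_continuous.
- by apply/derivable1_diffP; case: d1.
- by apply/derivable1_diffP; case: d2.
Qed.

Lemma gauss_decay_integrable f f' :
  cderive f f' -> gauss_decay1 f -> cintegrable f.
Proof.
move=> /continuous_cderive[cr ci] [K [c [K0 c0 Kc]]]; split.
- apply: (le_integrable_gauss (K := K) c0 cr) => x.
  exact: le_trans (normr_Re_le _) (Kc tt x I).
- apply: (le_integrable_gauss (K := K) c0 ci) => x.
  exact: le_trans (normr_Im_le _) (Kc tt x I).
Qed.

(** The derivative [f''] makes [f'] continuous, as the fundamental theorem of calculus asks. The two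
    decay bounds are merged by taking the larger constant and the smaller rate. *)
Lemma Cint_cderive_eq0 f f' f'' : cderive f f' -> cderive f' f'' ->
  gauss_decay1 f -> gauss_decay1 f' -> Cint f' = 0.
Proof.
move=> df /continuous_cderive[cr ci] [K [c [K0 c0 Kc]]] [L [d [L0 d0 Ld]]].
have le1 : forall x, K * expR (- c * x ^+ 2) <=
    Num.max K L * expR (- Num.min c d * x ^+ 2).
  move=> x; apply: ler_pM; rewrite ?expR_ge0// ?le_max ?lexx//.
  by rewrite ler_expR ler_wpM2r ?sqr_ge0// lerN2 ge_min lexx.
have le2 : forall x, L * expR (- d * x ^+ 2) <=
    Num.max K L * expR (- Num.min c d * x ^+ 2).
  move=> x; apply: ler_pM; rewrite ?expR_ge0// ?le_max ?lexx ?orbT//.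
  by rewrite ler_expR ler_wpM2r ?sqr_ge0// lerN2 ge_min lexx orbT.
have m0 : 0 < Num.min c d by rewrite lt_min c0.
apply: complex_ext => /=.
- apply: (Rintegral_derive_eq0 m0 (f := fun x => complex.Re (f x))
    (K := Num.max K L)) => // x; first by case: (df x).
  + exact: le_trans (normr_Re_le _) (le_trans (Kc tt x I) (le1 x)).
  + exact: le_trans (normr_Re_le _) (le_trans (Ld tt x I) (le2 x)).
- apply: (Rintegral_derive_eq0 m0 (f := fun x => complex.Im (f x))
    (K := Num.max K L)) => // x; first by case: (df x).
  + exact: le_trans (normr_Im_le _) (le_trans (Kc tt x I) (le1 x)).
  + exact: le_trans (normr_Im_le _) (le_trans (Ld tt x I) (le2 x)).
Qed.

End ComplexIntegral.

(** * Moments of a complex Gaussian weight *)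

Section GaussianMoments.
Variables (R : realType) (mu w : R[i]).
Hypothesis mu_gt0 : 0 < complex.Re mu.
Implicit Types P Q : {poly R[i]}.

Definition gauss_moment P :=
  Cint (fun x : R => P.[x%:C] * Cexp (- mu * (x%:C - w) ^+ 2)).

Lemma gauss_weight_decay :
  gauss_decay (fun _ : unit => True) (fun _ (x : R) => Cexp (- mu * (x%:C - w) ^+ 2)).
Proof.
apply: (@gauss_decay_Cexp R _ _ _ (complex.Re mu)
  (complex.Re (- mu * w ^+ 2)) `|complex.Re (2 * mu * w)|) => // _ x _.
have -> : - mu * (x%:C - w) ^+ 2 =
    - mu * w ^+ 2 + (2 * mu * w) * x%:C + (- mu) * (x ^+ 2)%:C.
  by rewrite rmorphXn /=; ring.
rewrite 2!ReD; apply: lerD; last first.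
  by rewrite ReMreal ReN mulNr.
by rewrite lerD2l ReMreal -normrM ler_norm.
Qed.

Lemma cderive_gauss_weight : cderive
  (fun x : R => Cexp (- mu * (x%:C - w) ^+ 2))
  (fun x => - (2 * mu * (x%:C - w)) * Cexp (- mu * (x%:C - w) ^+ 2)).
Proof.
have dl := cderiveD (@cderive_id R) (cderive_cst (- w)).
apply: cderive_eq
  (cderive_Cexp (cderiveM (cderive_cst (- mu)) (cderiveM dl dl))) _ _ => x.
  by rewrite -expr2.
by rewrite -expr2; ring.
Qed.

Lemma cderive_poly_gauss P : cderive
  (fun x : R => P.[x%:C] * Cexp (- mu * (x%:C - w) ^+ 2))
  (fun x => (P^`() - (2 * mu) *: (('X - w%:P) * P)).[x%:C] *
            Cexp (- mu * (x%:C - w) ^+ 2)).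
Proof.
apply: cderive_eq (cderiveM (cderive_horner P) cderive_gauss_weight) _ _ => x //.
by rewrite hornerD hornerN hornerZ hornerM hornerXsubC; ring.
Qed.

Lemma poly_gauss_decay P : gauss_decay (fun _ : unit => True)
  (fun _ (x : R) => P.[x%:C] * Cexp (- mu * (x%:C - w) ^+ 2)).
Proof. exact: gauss_decay_horner gauss_weight_decay. Qed.

Lemma poly_gauss_integrable P :
  cintegrable (fun x : R => P.[x%:C] * Cexp (- mu * (x%:C - w) ^+ 2)).
Proof. exact: gauss_decay_integrable (cderive_poly_gauss P) (poly_gauss_decay P). Qed.

Lemma gauss_momentD P Q : gauss_moment (P + Q) = gauss_moment P + gauss_moment Q.
Proof.
rewrite /gauss_moment -CintD; try exact: poly_gauss_integrable.
by apply: eq_Cint => x; rewrite hornerD mulrDl.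
Qed.

Lemma gauss_momentZ z P : gauss_moment (z *: P) = z * gauss_moment P.
Proof.
rewrite /gauss_moment -CintZl; last exact: poly_gauss_integrable.
by apply: eq_Cint => x; rewrite hornerZ -mulrA.
Qed.

Lemma gauss_momentXM P : gauss_moment ('X * P) =
  w * gauss_moment P + (2 * mu)^-1 * gauss_moment P^`().
Proof.
have mu0 : 2 * mu != 0.
  rewrite mulf_neq0 ?pnatr_eq0//; apply/eqP => mu0.
  by move: mu_gt0; rewrite mu0 ltxx.
have := Cint_cderive_eq0 (cderive_poly_gauss P) (cderive_poly_gauss _)
  (poly_gauss_decay _) (poly_gauss_decay _).
rewrite -/(gauss_moment _) mulrBl mul_polyC scalerBr opprB -scaleNr.
rewrite !gauss_momentD !gauss_momentZ => /eqP.
rewrite addrA addr_eq0 => /eqP h.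
apply: (mulfI mu0); rewrite mulrDr (mulrA _ _^-1) divff// mul1r.
move: h; set A := gauss_moment _; set B := gauss_moment P; set C := gauss_moment _.
move=> h; have -> : 2 * mu * C = - (- (2 * mu) * C) by ring.
by rewrite -h; ring.
Qed.

End GaussianMoments.

(** * Integrals that do not depend on a parameter *)

Section ParametricIntegral.
Variable R : realType.
Local Notation leb := (@lebesgue_measure R).
Local Open Scope classical_set_scope.

(** The Gaussian dominates the [t]-derivative near every [t], so differentiation goes under the
    integral sign; the result vanishes, hence the integral is constant. *)
Lemma Rintegral_param_cst (f f' : R -> R -> R) (K c : R) : 0 <= K -> 0 < c ->
  (forall t x : R, is_derive t 1 (fun t => f t x) (f' t x)) ->
  (forall t, leb.-integrable setT (EFin \o f t)) ->
  (forall t x, `|f' t x| <= K * expR (- c * x ^+ 2)) ->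
  (forall t, Rintegral leb setT (f' t) = 0) ->
  forall t1 t2, Rintegral leb setT (f t1) = Rintegral leb setT (f t2).
Proof.
move=> K0 c0 df intf f'K f'0 t1 t2.
apply: (is_derive_0_is_cst (f := fun t => Rintegral leb setT (f t))) => t.
have tI : `]t - 1, t + 1[%classic t by rewrite /= in_itv /=; lra.
have G0 x : 0 <= K * expR (- c * x ^+ 2) by rewrite mulr_ge0 ?expR_ge0.
have intG := integrable_gauss K c0.
have p1E s x : partial1of2 f s x = f' s x.
  by rewrite partial1of2E; case: (df s x).
have derf s x : `]t - 1, t + 1[%classic s -> [set: R] x -> derivable (f ^~ x) s 1.
  by move=> _ _; case: (df s x).
have intf' s : `]t - 1, t + 1[%classic s -> leb.-integrable setT (EFin \o f s).
  by move=> _; exact: intf.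
have Gub s x : `]t - 1, t + 1[%classic s -> [set: R] x ->
    `|partial1of2 f s x| <= K * expR (- c * x ^+ 2).
  by move=> _ _; rewrite p1E.
apply: DeriveDef.
  exact: (derivable_under_integral measurableT tI intf' derf G0 intG Gub).
rewrite -derive1E.
rewrite (differentiation_under_integral measurableT tI intf' derf G0 intG Gub).
by rewrite -[RHS](f'0 t); apply: eq_Rintegral => x _; exact: p1E.
Qed.

Lemma Cint_param_cst (F F' : R -> R -> R[i]) :
  (forall x, cderive (F ^~ x) (F' ^~ x)) ->
  (forall t, cintegrable (F t)) ->
  gauss_decay (fun=> True) F' ->
  (forall t, Cint (F' t) = 0) ->
  forall t1 t2, Cint (F t1) = Cint (F t2).
Proof.
move=> dF iF [K [c [K0 c0 Kc]]] F'0 t1 t2; apply: complex_ext => /=.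
- apply: (@Rintegral_param_cst (fun t x => complex.Re (F t x))
    (fun t x => complex.Re (F' t x)) K c) => //.
  + by move=> t x; case: (dF x t).
  + by move=> t; case: (iF t).
  + by move=> t x; exact: le_trans (normr_Re_le _) (Kc t x I).
  + by move=> t; have := F'0 t => /(congr1 (@complex.Re R)).
- apply: (@Rintegral_param_cst (fun t x => complex.Im (F t x))
    (fun t x => complex.Im (F' t x)) K c) => //.
  + by move=> t x; case: (dF x t).
  + by move=> t; case: (iF t).
  + by move=> t x; exact: le_trans (normr_Im_le _) (Kc t x I).
  + by move=> t; have := F'0 t => /(congr1 (@complex.Im R)).
Qed.

End ParametricIntegral.

(** * Contour deformation and the value of the complex Gaussian integral *)

Section BoundedFunctions.
Variables (R : realType) (T : Type).
Implicit Types b : T -> R[i].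

(** For the coefficients that depend on the parameter only: being bounded, they preserve uniform
    decay. *)
Definition cbounded b := exists M : R, forall t, normc (b t) <= M.

Lemma cbounded_cst (z : R[i]) : cbounded (fun=> z).
Proof. by exists (normc z). Qed.

Lemma cboundedD b1 b2 : cbounded b1 -> cbounded b2 ->
  cbounded (fun t => b1 t + b2 t).
Proof.
move=> [M h] [N k]; exists (M + N) => t.
by apply: le_trans (le_normcD _ _) _; exact: lerD.
Qed.

Lemma cboundedM b1 b2 : cbounded b1 -> cbounded b2 ->
  cbounded (fun t => b1 t * b2 t).
Proof.
move=> [M h] [N k]; exists (M * N) => t.
by rewrite ComplexField.Normc.normcM ler_pM ?normc_ge0.
Qed.

Lemma gauss_decayM_cbounded b (f : T -> R -> R[i]) : cbounded b ->
  gauss_decay (fun=> True) f -> gauss_decay (fun=> True) (fun t x => b t * f t x).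
Proof. by move=> [M bM]; apply: (gauss_decayM_bounded (M := M)). Qed.

End BoundedFunctions.

(* As [t] goes from 0 to 1, the contour [x |-> x + t ((s - 1) x - v)] deforms
   the real line into [x |-> s x - v]; the [t]-derivative of the integrand is an
   exact [x]-derivative, so the integral does not change.  Taking [t] to be
   [sin^2 th] makes the parameter range over the whole line. *)
Section GaussianHomotopy.
Variables (R : realType) (s v : R[i]).
Hypothesis s_cone : `|complex.Im s| < complex.Re s.

Let t (th : R) : R := sin th ^+ 2.
Let t' (th : R) : R := 2 * sin th * cos th.
Let S th : R[i] := 1 + (t th)%:C * (s - 1).
Let L th (x : R) : R[i] := S th * x%:C - (t th)%:C * v.
Let E th x : R[i] := Cexp (- (L th x * L th x)).

Let t_01 th : 0 <= t th <= 1.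
Proof.
rewrite /t sqr_ge0 /= -(cos2Dsin2 th) lerDr; exact: sqr_ge0.
Qed.

Let t_bounded : cbounded (fun th => (t th)%:C).
Proof.
exists 1 => th; rewrite normc_real.
by have /andP[t0 t1] := t_01 th; rewrite ger0_norm.
Qed.

Let t'_bounded : cbounded (fun th => (t' th)%:C).
Proof.
exists 1 => th; rewrite normc_real ler_norml /t'; move: (cos2Dsin2 th).
by have := sqr_ge0 (cos th + sin th); have := sqr_ge0 (cos th - sin th); nra.
Qed.

Let S_bounded : cbounded S.
Proof.
apply: cboundedD; first exact: cbounded_cst.
by apply: cboundedM => //; exact: cbounded_cst.
Qed.

Let t_derive (th : R) : is_derive th 1 t (t' th).
Proof.
rewrite /t; apply: is_derive_eq.
by rewrite /t' /GRing.scale /=; ring.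
Qed.

(** [s_cone] puts [s] in the sector [|arg s| < pi / 4]. On the segment from 1 to [s] the concave
    function [Re - |Im|] is at least its smaller end value, [m] say, so
    [p^2 - q^2 = (p - |q|) (p + |q|) >= m^2]. *)
Let Re_sqrS th : Num.min 1 (complex.Re s - `|complex.Im s|) ^+ 2 <=
  complex.Re (S th * S th).
Proof.
have [m mE] : exists m, m = Num.min 1 (complex.Re s - `|complex.Im s|) by eexists.
have m0 : 0 < m by rewrite mE lt_min ltr01 subr_gt0.
have m1 : m <= 1 by rewrite mE ge_min lexx.
have ms : m <= complex.Re s - `|complex.Im s| by rewrite mE ge_min lexx orbT.
rewrite -mE; have /andP[t0 t1] := t_01 th.
rewrite ReM.
have -> : complex.Re (S th) = 1 + t th * (complex.Re s - 1).
  by rewrite /S mulrC ReD ReMreal /= ReD ReN /= mulrC.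
have -> : complex.Im (S th) = t th * complex.Im s.
  by rewrite /S mulrC ImD ImMreal ImD ImN /= oppr0 addr0 add0r mulrC.
set p := 1 + _; set q := t th * _.
have pq : m <= p - `|q|.
  by rewrite /p /q normrM (ger0_norm t0); nra.
have q0 := normr_ge0 q.
have -> : p * p - q * q = p ^+ 2 - `|q| ^+ 2 by rewrite real_normK ?num_real// !expr2.
nra.
Qed.

Let E_decay : gauss_decay (fun=> True) E.
Proof.
have [V hV] : cbounded (fun th => - ((t th)%:C * v * ((t th)%:C * v))).
  have h : cbounded (fun th => (t th)%:C * v).
    by apply: cboundedM => //; exact: cbounded_cst.
  have [M hM] := cboundedM h h; exists M => th; by rewrite normcN.
have [W hW] : cbounded (fun th => 2 * (S th * ((t th)%:C * v))).
  apply: cboundedM; first exact: cbounded_cst.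
  by apply: cboundedM => //; apply: cboundedM => //; exact: cbounded_cst.
apply: (@gauss_decay_Cexp R _ _ _
  (Num.min 1 (complex.Re s - `|complex.Im s|) ^+ 2) V W).
  by rewrite exprn_gt0// lt_min ltr01 subr_gt0.
move=> th x _.
have -> : - (L th x * L th x) = - ((t th)%:C * v * ((t th)%:C * v)) +
   2 * (S th * ((t th)%:C * v)) * x%:C + - (S th * S th) * (x ^+ 2)%:C.
  by rewrite /L rmorphXn /=; ring.
rewrite 2!ReD !ReMreal; apply: lerD; last first.
  by rewrite ReN mulNr lerN2 ler_wpM2r ?sqr_ge0.
apply: lerD.
  by apply: le_trans (hV th); apply: le_trans (normr_Re_le _); exact: ler_norm.
apply: le_trans (ler_norm _) _; rewrite normrM ler_wpM2r//.
exact: le_trans (normr_Re_le _) (hW th).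
Qed.

Let cderive_L th : cderive (L th) (fun=> S th).
Proof.
apply: cderive_eq (cderiveD (cderiveM (cderive_cst (S th)) (@cderive_id R))
  (cderive_cst (- ((t th)%:C * v)))) _ _ => x //.
by rewrite mul0r mulr1 addr0 add0r.
Qed.

Let cderive_E th : cderive (E th) (fun x => - (2 * (S th * L th x)) * E th x).
Proof.
apply: cderive_eq
  (cderive_Cexp (cderiveN (cderiveM (cderive_L th) (cderive_L th)))) _ _ => x //.
by rewrite -/(E th x); ring.
Qed.

(** [u] is the derivative of [L] in [t], as [S] is its derivative in [x]. By equality of mixed
    derivatives, the [t]-derivative of [S exp (- L^2)] is the [x]-derivative of [u exp (- L^2)];
    [F'] carries in addition the chain rule factor [t']. *)
Let u (x : R) : R[i] := (s - 1) * x%:C - v.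

Let cderive_u : cderive u (fun=> s - 1).
Proof.
apply: cderive_eq (cderiveD (cderiveM (cderive_cst (s - 1)) (@cderive_id R))
  (cderive_cst (- v))) _ _ => x //.
by rewrite mul0r mulr1 addr0 add0r.
Qed.

Let F th x := S th * E th x.
Let F' th x := (t' th)%:C * ((s - 1) - 2 * (u x * (S th * L th x))) * E th x.

Let cderive_F_param x : cderive (F ^~ x) (F' ^~ x).
Proof.
have dt := cderive_real t_derive.
have dS := cderiveD (cderive_cst 1) (cderiveM dt (cderive_cst (s - 1))).
have dL := cderiveD (cderiveM dS (cderive_cst x%:C)) (cderiveN (cderiveM dt (cderive_cst v))).
have dE := cderive_Cexp (cderiveN (cderiveM dL dL)).
apply: cderive_eq (cderiveM dS dE) _ _ => th //.
by rewrite /F' /E -/(S th) -/(L th x) /u; ring.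
Qed.

Let cderive_tuE th : cderive (fun x => (t' th)%:C * (u x * E th x)) (F' th).
Proof.
apply: cderive_eq (cderiveM (cderive_cst (t' th)%:C)
  (cderiveM cderive_u (cderive_E th))) _ _ => x //.
by rewrite /F'; ring.
Qed.

Let F'_decay : gauss_decay (fun=> True) F'.
Proof.
have E1 := gauss_decayMx E_decay; have E2 := gauss_decayMx E1.
have cb (z : R[i]) : cbounded (fun _ : R => z) := cbounded_cst _ z.
have bM b1 b2 := @cboundedM R R b1 b2.
have bD b1 b2 := @cboundedD R R b1 b2.
(* The next three functions are the coefficients of [x^2], [x] and 1 in [F'] divided by [E], after
   expansion of the product of [u] and [L]. *)
have b2 : cbounded (fun th => (t' th)%:C * (- 2 * (s - 1) * (S th * S th))).
  by do ?[exact: (cb)|apply: (bM)].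
have b1 : cbounded (fun th => (t' th)%:C *
    (2 * v * (S th * S th) + 2 * (s - 1) * v * (S th * (t th)%:C))).
  by do ?[exact: (cb)|apply: (bM)|apply: (bD)].
have b0 : cbounded (fun th => (t' th)%:C * ((s - 1) + - 2 * v * v * (S th * (t th)%:C))).
  by do ?[exact: (cb)|apply: (bM)|apply: (bD)].
apply: gauss_decay_eq (gauss_decayD (gauss_decayM_cbounded b2 E2)
  (gauss_decayD (gauss_decayM_cbounded b1 E1) (gauss_decayM_cbounded b0 E_decay))) _.
by move=> th x; rewrite /F' /u /L; ring.
Qed.

Let decay_slice (f : R -> R -> R[i]) th : gauss_decay (fun=> True) f ->
  gauss_decay (fun _ : unit => True) (fun=> f th).
Proof. by move=> [K [c [K0 c0 Kc]]]; exists K, c; split=> // _ x _; exact: Kc. Qed.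

Let Cint_F'_eq0 th : Cint (F' th) = 0.
Proof.
(* The derivative of [F' th] in [x], for its continuity. *)
have dM := cderiveM (cderiveM (cderive_cst (t' th)%:C) (cderiveD (cderive_cst (s - 1))
  (cderiveN (cderiveM (cderive_cst 2)
    (cderiveM cderive_u (cderiveM (cderive_cst (S th)) (cderive_L th)))))))
  (cderive_E th).
apply: (Cint_cderive_eq0 (cderive_tuE th) dM); last exact: decay_slice.
have E1 := gauss_decayMx E_decay.
have dtu := gauss_decayMl (s - 1) E1.
apply: (@decay_slice (fun a x => (t' th)%:C * (u x * E a x))).
apply: gauss_decay_eq (gauss_decayMl (t' th)%:C
  (gauss_decayD dtu (gauss_decayMl (- v) E_decay))) _ => a x.
by rewrite /u; ring.
Qed.

Lemma Cint_gauss_homotopy :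
  s * Cint (fun x => Cexp (- (s * x%:C - v) ^+ 2)) = (Num.sqrt pi)%:C.
Proof.
have iE th : cintegrable (E th).
  by apply: gauss_decay_integrable (cderive_E th) _; exact: decay_slice.
have iF th : cintegrable (F th).
  apply: gauss_decay_integrable
    (cderiveM (cderive_cst (S th)) (cderive_E th)) _.
  by apply: (@decay_slice F); exact: gauss_decayM_cbounded.
(* At [pi / 2] the contour is [s x - v]; at 0 it is the real line, with the classical Gaussian
   integral. *)
have := Cint_param_cst cderive_F_param iF F'_decay Cint_F'_eq0 (pi / 2) 0.
have t1 : t (pi / 2) = 1 by rewrite /t sin_pihalf expr1n.
have t0 : t 0 = 0 by rewrite /t sin0 expr0n.
rewrite /F CintZl// CintZl//.
have -> : S (pi / 2) = s by rewrite /S t1; ring.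
have S0 : S 0 = 1 by rewrite /S t0; ring.
rewrite S0 mul1r.
have -> : Cint (E (pi / 2)) = Cint (fun x => Cexp (- (s * x%:C - v) ^+ 2)).
  by apply: eq_Cint => x; rewrite /E /L /S t1; congr Cexp; ring.
move=> ->.
have -> : Cint (E 0) = Cint (fun x : R => (gauss_fun x)%:C).
  apply: eq_Cint => x; rewrite /E /L S0 t0 mul1r mul0r subr0.
  rewrite (_ : - (x%:C * x%:C) = (- x ^+ 2)%:C); last first.
    by rewrite rmorphN rmorphXn.
  by rewrite /Cexp /= cos0 sin0 mulr1 mulr0.
rewrite /Cint /=; apply: complex_ext => /=; last by rewrite Rintegral_cst ?mul0r.
by rewrite /Rintegral integralT_gauss.
Qed.

End GaussianHomotopy.

(** With [s] the principal root of [mu], [mu (x - w)^2 = (s x - s w)^2]. The sector condition on [s]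
    follows from [Re s >= 0], which the principal branch provides, and [Re (s^2) = Re mu > 0]. *)
Lemma gauss_moment1 (R : realType) (mu w : R[i]) : 0 < complex.Re mu ->
  sqrtc mu * gauss_moment mu w 1 = (Num.sqrt pi)%:C.
Proof.
move=> mu0; set s := sqrtc mu.
have sE : s ^+ 2 = mu by rewrite sqr_sqrtc.
have Rs : 0 <= complex.Re s by rewrite /s; case: (mu) => a b /=; exact: sqrtr_ge0.
rewrite -(@Cint_gauss_homotopy R s (s * w)).
  congr (_ * _); apply: eq_Cint => x; rewrite hornerC mul1r; congr Cexp.
  by rewrite -sE; ring.
rewrite -(ger0_norm Rs) -ltr_sqr ?nnegrE// !real_normK ?num_real//.
rewrite -subr_gt0 !expr2 -ReM -expr2 sE; exact: mu0.
Qed.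

(** * The heat operator on polynomials and the proportionality equation *)

Section Appell.
Variable F : numFieldType.
Implicit Types (k al be a b : F) (P Q : {poly F}).

(* [exp (k D^2) X^n], [D] being differentiation. *)
Fixpoint appell k (n : nat) : {poly F} :=
  if n is m.+1 then 'X * appell k m + (2 * k) *: (appell k m)^`() else 1.

Lemma appellS k n :
  appell k n.+1 = 'X * appell k n + (2 * k) *: (appell k n)^`().
Proof. by []. Qed.

(** The Appell property, since [D] commutes with [exp (k D^2)]. It reduces every coefficient to a
    constant term. *)
Lemma deriv_appell k n : (appell k n.+1)^`() = n.+1%:R *: appell k n.
Proof.
elim: n => [|n IH].
  by rewrite /= mulr1 -polyC1 derivC scaler0 addr0 derivX scale1r.
rewrite appellS derivD derivM derivX mul1r derivZ IH derivZ -scalerAr.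
rewrite [_ *: (_ *: _)]scalerA [_ * n.+1%:R]mulrC -scalerA -addrA -scalerDr -appellS.
by rewrite [in RHS]mulrS scalerDl scale1r.
Qed.

Lemma size_appell_le k n : (size (appell k n) <= n.+1)%N.
Proof.
elim: n => [|n IH]; first by rewrite /= size_poly1.
apply: leq_trans (size_polyD _ _) _; rewrite geq_max; apply/andP; split.
- by apply: leq_trans (size_polyMleq _ _) _; rewrite size_polyX /= ltnS.
- apply: leq_trans (size_scale_leq _ _) _; apply/leq_sizeP => j nj.
  by rewrite coef_deriv nth_default ?mul0rn//; exact: leq_trans IH (leqW (ltnW nj)).
Qed.

Lemma coef_appell_top k n : (appell k n)`_n = 1.
Proof.
elim: n => [|n IH]; first by rewrite /= coef1.
rewrite /= coefD coefXM /= IH coefZ coef_deriv nth_default ?mul0rn ?mulr0 ?addr0//.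
exact: leq_trans (size_appell_le _ _) _.
Qed.

Lemma coef_appell0 k n : (appell k n.+2)`_0 = 2 * k * n.+1%:R * (appell k n)`_0.
Proof.
by rewrite [appell k n.+2]/= coefD coefXM /= add0r -/(appell k n.+1) deriv_appell
  !coefZ mulrA.
Qed.

Lemma coef_appell0_odd k j : (appell k j.*2.+1)`_0 = 0.
Proof.
elim: j => [|j IH]; last by rewrite doubleS coef_appell0 IH mulr0.
by rewrite /= mulr1 -polyC1 derivC scaler0 addr0 coefX.
Qed.

Lemma coef_appell0_even k j : (appell k j.*2)`_0 * j`!%:R = j.*2`!%:R * k ^+ j.
Proof.
elim: j => [|j IH]; first by rewrite /= coef1 !(mul1r, mulr1, expr0).
rewrite doubleS coef_appell0 !factS !natrM exprS.
transitivity (2 * k * j.*2.+1%:R * j.+1%:R * ((appell k j.*2)`_0 * j`!%:R)).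
  by ring.
rewrite IH (_ : j.*2.+2%:R = 2 * j.+1%:R :> F); first by ring.
by rewrite -natrM mul2n doubleS.
Qed.

(** Differentiating [m] times brings the coefficient of [x^m] down to the constant term. *)
Lemma coef_appell_shift k m i :
  (appell k (m + i))`_m * m`!%:R * i`!%:R = (m + i)`!%:R * (appell k i)`_0.
Proof.
elim: m => [|m IH]; first by rewrite add0n mulr1 mulrC.
have := congr1 (fun p : {poly F} => p`_m) (deriv_appell k (m + i)).
rewrite coef_deriv coefZ -addSn => h.
rewrite addSn !factS !natrM -mulrA [(m + i).+1%:R * _]mulrC.
rewrite [RHS]mulrAC -IH -addSn.
transitivity ((appell k (m.+1 + i))`_m.+1 *+ m.+1 * m`!%:R * i`!%:R).
  by rewrite -mulr_natr; ring.
by rewrite h; ring.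
Qed.

Lemma coef_appell_odd k m j : (appell k (m + j.*2.+1))`_m = 0.
Proof.
have := coef_appell_shift k m j.*2.+1; rewrite coef_appell0_odd mulr0 => /eqP.
by rewrite !mulf_eq0 !pnatr_eq0 !gtn_eqF ?fact_gt0// !orbF => /eqP.
Qed.

Lemma coef_appell_even k m j :
  (appell k (m + j.*2))`_m * (m`!%:R * j`!%:R) = (m + j.*2)`!%:R * k ^+ j.
Proof.
have := coef_appell_shift k m j.*2.
have := coef_appell0_even k j => h0 h1.
have f0 : j.*2`!%:R != 0 :> F by rewrite pnatr_eq0 gtn_eqF ?fact_gt0.
apply: (mulfI f0); rewrite [RHS]mulrCA -h0.
transitivity ((appell k (m + j.*2))`_m * m`!%:R * j.*2`!%:R * j`!%:R); first by ring.
by rewrite h1; ring.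
Qed.

(** [D^2] kills polynomials of degree at most 1, so [exp (k D^2)] fixes them. *)
Lemma appell_small k l n : (n <= 1)%N -> appell k n = appell l n.
Proof. by case: n => [|[|]]//= _; rewrite -polyC1 derivC !scaler0. Qed.

(** Substituting [a x] for [x] turns [D] into [D / a], hence [k D^2] into [(k / a^2) D^2]. *)
Lemma appell_comp_scale k a n : a != 0 ->
  appell k n \Po (a *: 'X) = a ^+ n *: appell (k / a ^+ 2) n.
Proof.
move=> a0; elim: n => [|n IH]; first by rewrite /= expr0 scale1r -polyC1 comp_polyC.
rewrite /= comp_polyD comp_polyM comp_polyX comp_polyZ IH.
have h : (appell k n)^`() \Po (a *: 'X) = (a ^+ n / a) *: (appell (k / a ^+ 2) n)^`().
  apply: (@scalerI _ _ a) => //.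
  rewrite scalerA mulrCA divff// mulr1 -derivZ -IH deriv_comp derivZ derivX.
  by rewrite alg_polyC mulrC mul_polyC.
rewrite h scalerDr !scalerA -scalerAl -scalerAr scalerA -exprS; congr (_ + _ *: _).
by rewrite exprS; field.
Qed.

(* [exp (al D^2) P] *)
Definition heat al P : {poly F} := \sum_(i < size P) P`_i *: appell al i.

Lemma heat_widen al P n : (size P <= n)%N ->
  heat al P = \sum_(i < n) P`_i *: appell al i.
Proof.
move=> Pn; rewrite /heat (big_ord_widen n (fun i => P`_i *: appell al i))// big_mkcond.
apply: eq_bigr => i _; case: ltnP => // Pi.
by rewrite nth_default// scale0r.
Qed.

Lemma heat_is_linear al : linear (heat al).
Proof.
move=> c P Q; pose n := maxn (size P) (size Q).
rewrite !(@heat_widen _ _ n) ?leq_maxl ?leq_maxr//.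
  rewrite scaler_sumr -big_split; apply: eq_bigr => i _ /=.
  by rewrite coefD coefZ scalerDl scalerA.
by apply: leq_trans (size_polyD _ _) _; rewrite geq_max leq_maxr andbT
  (leq_trans (size_scale_leq _ _))// leq_maxl.
Qed.

HB.instance Definition _ al :=
  GRing.isLinear.Build F {poly F} {poly F} _ (heat al) (heat_is_linear al).

Lemma heatXn al n : heat al 'X^n = appell al n.
Proof.
rewrite /heat size_polyXn big_ord_recr /= coefXn eqxx scale1r big1 ?add0r// => i _.
by rewrite coefXn ltn_eqF// scale0r.
Qed.

Lemma linear_poly_eq (V : lmodType F) (f g : {linear {poly F} -> V}) :
  (forall n, f 'X^n = g 'X^n) -> f =1 g.
Proof.
move=> fg P; rewrite -[P]coefK poly_def !linear_sum; apply: eq_bigr => i _.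
by rewrite !linearZ /= fg.
Qed.

Lemma heat_deriv al P : heat al P^`() = (heat al P)^`().
Proof.
apply: (linear_poly_eq (f := heat al \o @deriv F) (g := @deriv F \o heat al)) => -[|n] /=.
  by rewrite heatXn /= expr0 -polyC1 derivC linear0.
by rewrite derivXn /= linearMn /= !heatXn deriv_appell scaler_nat.
Qed.

(** From the commutation [D^2 X = X D^2 + 2 D]. With [al = 1 / (4 mu)] this is the recursion of
    [gauss_momentXM]. *)
Lemma heatXM al P : heat al ('X * P) = 'X * heat al P + (2 * al) *: (heat al P)^`().
Proof.
rewrite -[P]coefK poly_def [in LHS]mulr_sumr !(linear_sum (heat al)) [in RHS]mulr_sumr.
rewrite (linear_sum (@deriv F)) scaler_sumr -big_split; apply: eq_bigr => i _ /=.
rewrite -scalerAr !linearZ /= -exprS !heatXn -scalerAr.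
by rewrite -scalerDr -appellS.
Qed.

(** Semigroup law: [exp (al D^2) exp (k D^2) = exp ((k + al) D^2)]. *)
Lemma heat_appell al k n : heat al (appell k n) = appell (k + al) n.
Proof.
elim: n => [|n IH]; first by have := heatXn al 0; rewrite expr0.
rewrite /= linearD linearZ /= heatXM heat_deriv IH -addrA -scalerDl.
by rewrite -mulrDr [al + k]addrC.
Qed.

Lemma coef_heat_top al P n : (size P <= n.+1)%N -> (heat al P)`_n = P`_n.
Proof.
move=> Pn; rewrite (heat_widen _ Pn) coef_sum big_ord_recr /= coefZ coef_appell_top.
rewrite mulr1 big1 ?add0r// => i _; rewrite coefZ [_`_n]nth_default ?mulr0//.
exact: leq_trans (size_appell_le _ _) (ltn_ord i).
Qed.

Lemma coef_comp_scale P c i : (P \Po (c *: 'X))`_i = P`_i * c ^+ i.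
Proof.
rewrite comp_polyE coef_sum.
under eq_bigr do rewrite exprZn scalerA coefZ coefXn.
case: (ltnP i (size P)) => iP.
  rewrite (bigD1 (Ordinal iP)) //= eqxx mulr1 big1 ?addr0// => j ji.
  rewrite [i == _]eq_sym (_ : (j == i :> nat) = false) ?mulr0//.
  by apply/negbTE; apply: contraNneq ji => ji; apply/eqP/val_inj.
rewrite nth_default// mul0r big1// => j _.
by rewrite gtn_eqF ?mulr0// (leq_trans (ltn_ord j)).
Qed.

Definition heat_proportional al be a b (C : F) P :=
  heat al P \Po (a *: 'X) = C *: (heat be P \Po (b *: 'X)).

Lemma heat_proportional_factor al be a b C P n : a != 0 -> b != 0 ->
  size P = n.+1 -> heat_proportional al be a b C P -> C = (a / b) ^+ n.
Proof.
move=> a0 b0 sP /(congr1 (fun p : {poly F} => p`_n)).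
rewrite coefZ !coef_comp_scale !coef_heat_top ?sP// => h.
have P0 : P`_n != 0.
  by rewrite -[n]/n.+1.-1 -sP -/(lead_coef P) lead_coef_eq0 -size_poly_eq0 sP.
rewrite expr_div_n; apply: (mulIf (expf_neq0 n b0)); apply: (mulfI P0).
by rewrite divfK ?expf_neq0// h mulrCA.
Qed.

(** A nonzero solution of degree [m < n] would force [(a / b)^m = (a / b)^n], that is
    [a^(n - m) = b^(n - m)]. *)
Lemma heat_proportional_inj al be a b P n : a != 0 -> b != 0 ->
  (forall j, (1 <= j <= n)%N -> a ^+ j != b ^+ j) -> (size P <= n)%N ->
  heat_proportional al be a b ((a / b) ^+ n) P -> P = 0.
Proof.
move=> a0 b0 ab Pn h; apply/eqP/contraT => P0.
have [m sP] : exists m, size P = m.+1.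
  by exists (size P).-1; rewrite prednK// size_poly_gt0.
have mn : (m < n)%N by rewrite -sP.
have := heat_proportional_factor a0 b0 sP h.
rewrite -(subnK (ltnW mn)) exprD -[X in _ = X]mul1r => /(mulIf _) h1.
have := ab (n - m)%N; rewrite subn_gt0 mn leq_subr => /(_ isT) /eqP; case.
have : (a / b) ^+ (n - m) = 1 by apply: h1; rewrite expf_neq0// mulf_neq0 ?invr_eq0.
rewrite expr_div_n => /(congr1 ( *%R^~ (b ^+ (n - m)))).
by rewrite divfK ?expf_neq0// mul1r.
Qed.

(** By the semigroup law and scaling, the two sides are multiples of [appell] with parameters
    [(k + al) / a^2] and [(k + be) / b^2], which the condition on [k] equates. *)
Lemma heat_proportional_appell al be a b k n : a != 0 -> b != 0 ->
  ((1 < n)%N -> (k + al) * b ^+ 2 = (k + be) * a ^+ 2) ->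
  heat_proportional al be a b ((a / b) ^+ n) (appell k n).
Proof.
move=> a0 b0 hk; rewrite /heat_proportional !heat_appell !appell_comp_scale// scalerA.
rewrite expr_div_n divfK ?expf_neq0//; congr (_ *: _).
case: (leqP n 1) => n1; first exact: appell_small.
by congr appell; apply/eqP; rewrite eqr_div ?expf_neq0// hk.
Qed.

Lemma heat_proportionalZD al be a b C c P Q :
  heat_proportional al be a b C P -> heat_proportional al be a b C Q ->
  heat_proportional al be a b C (c *: P + Q).
Proof. by rewrite /heat_proportional !linearP /= => -> ->. Qed.

Lemma heat_proportionalE al be a b k P n : a != 0 -> b != 0 ->
  (forall j, (1 <= j <= n)%N -> a ^+ j != b ^+ j) -> size P = n.+1 ->
  ((1 < n)%N -> (k + al) * b ^+ 2 = (k + be) * a ^+ 2) ->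
  (exists C, heat_proportional al be a b C P) <-> P = P`_n *: appell k n.
Proof.
move=> a0 b0 ab sP hk; have hA := heat_proportional_appell a0 b0 hk.
have h0 : heat_proportional al be a b ((a / b) ^+ n) 0.
  by rewrite /heat_proportional !linear0.
split=> [[C hC]|->]; last first.
  by exists ((a / b) ^+ n); rewrite -[_ *: _]addr0; exact: heat_proportionalZD.
have CE := heat_proportional_factor a0 b0 sP hC; rewrite CE in hC.
apply/eqP; rewrite -subr_eq0; apply/eqP.
(* The difference with the known solution of the same leading coefficient is again a solution, of
   degree below [n]. *)
apply: (heat_proportional_inj (al := al) (be := be) a0 b0 ab); last first.
  by rewrite addrC -scaleNr; exact: heat_proportionalZD.
apply/leq_sizeP => j; rewrite leq_eqVlt => /orP[/eqP <-|nj].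
  by rewrite coefB coefZ coef_appell_top mulr1 subrr.
rewrite coefB coefZ [P`_j]nth_default ?sP// [(appell k n)`_j]nth_default ?mulr0 ?subrr//.
exact: leq_trans (size_appell_le _ _) nj.
Qed.

End Appell.

(** * Coefficients: closed form and recursion *)

Section AppellExpansion.
Variable F : numFieldType.
Implicit Types (k delta : F) (P Q : {poly F}).

(** In characteristic 0 the naturals are infinitely many test points; being real, they also serve
    for identities known on the real line only. *)
Lemma poly_eq_nat P Q : (forall n : nat, P.[n%:R] = Q.[n%:R]) -> P = Q.
Proof.
move=> PQ; apply/eqP; rewrite -subr_eq0; apply/eqP.
apply: (@roots_geq_poly_eq0 _ _ [seq i%:R | i <- iota 0 (size (P - Q))]).
- by apply/allP => _ /mapP[i _ ->]; rewrite /root hornerD hornerN PQ subrr.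
- by rewrite map_inj_uniq ?iota_uniq// => i j /eqP; rewrite eqr_nat => /eqP.
- by rewrite size_map size_iota.
Qed.

(** Indexed from the top like the [c_j], with denominators cleared:
    [c_(2 j) = c_0 n! k^j / ((n - 2 j)! j!)]. *)
Definition appell_coefs k P n :=
  (forall j, (2 * j + 1 <= n)%N -> P`_(n - (2 * j + 1)) = 0) /\
  (forall j, (2 * j <= n)%N ->
    P`_(n - 2 * j) * ((n - 2 * j)`!%:R * j`!%:R) = P`_n * (n`!%:R * k ^+ j)).

Lemma appell_coefsP k P n : (size P <= n.+1)%N ->
  appell_coefs k P n <-> P = P`_n *: appell k n.
Proof.
move=> sP; split=> [[Podd Peven]|PE].
  apply/polyP => i; rewrite coefZ; case: (ltnP n i) => ni.
    rewrite [P`_i]nth_default ?(leq_trans sP)// [(appell k n)`_i]nth_default ?mulr0//.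
    exact: leq_trans (size_appell_le _ _) ni.
  (* The parity of [n - i] decides between a vanishing coefficient and the closed form. *)
  have nE : n = (i + odd (n - i) + (n - i)./2.*2)%N.
    by rewrite -addnA odd_double_half subnKC.
  move: nE; set j := (n - i)./2; case: (odd _) => nE.
    have := Podd j; rewrite (_ : (n - _)%N = i); last first.
      by rewrite nE mul2n; lia.
    move=> -> //; last by rewrite nE mul2n; lia.
    by rewrite {2}nE -addnA add1n coef_appell_odd mulr0.
  rewrite addn0 in nE; have jn : (2 * j <= n)%N by rewrite nE mul2n leq_addl.
  have := Peven j jn; rewrite (_ : (n - _)%N = i); last by rewrite nE mul2n addnK.
  move=> e.
  have f0 : i`!%:R * j`!%:R != 0 :> F.
    by rewrite -natrM pnatr_eq0 gtn_eqF// muln_gt0 !fact_gt0.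
  apply: (mulIf f0); rewrite -mulrA {2}nE coef_appell_even -nE.
  exact: e.
split=> j jn; rewrite PE !coefZ ?coef_appell_top ?mulr1.
  move: (subnK jn); set m := (n - _)%N; rewrite addn1 mul2n => nE.
  by rewrite -{2}nE coef_appell_odd mulr0.
rewrite -mulrA; congr (_ * _).
move: (subnK jn); set m := (n - _)%N; rewrite mul2n => nE.
by rewrite -{1}nE coef_appell_even nE.
Qed.

(** The recursion is the ratio of consecutive closed forms: [(n - 2 j)! c_(2 j)] gets multiplied by
    [k / (j + 1)], the inverse of [- 2 delta (2 j + 2)]. Such a step occurs only when [n >= 2],
    hence the guard on the relation between [k] and [delta]. *)
Lemma appell_coefs_rec k delta P n : ((1 < n)%N -> - 4 * delta * k = 1) ->
  let c := fun j : nat => P`_(n - j) in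
  appell_coefs k P n <->
  (forall j, (2 * j + 1 <= n)%N -> c (2 * j + 1)%N = 0) /\
  (forall j, (2 * j + 2 <= n)%N ->
     (n - 2 * j)`!%:R * c (2 * j)%N
     = - 2%:R * delta * (2 * j + 2)%:R * (n - 2 * j - 2)`!%:R * c (2 * j + 2)%N).
Proof.
move=> kdelta c.
have fact_neq0 j : j`!%:R != 0 :> F by rewrite pnatr_eq0 gtn_eqF ?fact_gt0.
have double_succ j : (2 * j + 2)%:R = 2 * j.+1%:R :> F.
  by rewrite -natrM mulnS addnC.
split=> -[codd ceven]; split=> // j jn.
  have n1 : (1 < n)%N by apply: leq_trans jn; rewrite leq_addl.
  have jn' : (2 * j.+1 <= n)%N by rewrite mulnS addnC.
  have h1 := ceven j (leq_trans (leq_addr _ _) jn).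
  have h2 := ceven _ jn'; rewrite mulnS addnC factS natrM exprS in h2.
  rewrite /c -subnDA double_succ; apply: (mulIf (fact_neq0 j)).
  transitivity (P`_n * (n`!%:R * k ^+ j)); first by rewrite -h1; ring.
  transitivity (- 4 * delta * (P`_n * (n`!%:R * (k * k ^+ j)))); last first.
    by rewrite -h2; ring.
  by rewrite -[LHS]mul1r -[X in X * _](kdelta n1); ring.
elim: j jn => [|j IH] jn; first by rewrite muln0 subn0 expr0 fact0.
have jn' : (2 * j + 2 <= n)%N by rewrite addnC -mulnS.
have n1 : (1 < n)%N by apply: leq_trans jn'; rewrite leq_addl.
have h1 := IH (leq_trans (leq_addr _ _) jn').
have := ceven j jn'; rewrite /c -subnDA double_succ => h2.
rewrite mulnS addnC factS natrM exprS.
transitivity (k * (- 4 * delta * (P`_(n - (2 * j + 2)) *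
    ((n - (2 * j + 2))`!%:R * (j.+1%:R * j`!%:R))))).
  set X := P`__ * _; have -> : k * (- 4 * delta * X) = - 4 * delta * k * X by ring.
  by rewrite kdelta// mul1r.
transitivity (k * (P`_n * (n`!%:R * k ^+ j))); last by ring.
by congr (k * _); rewrite -h1 [P`_(n - 2 * j) * _]mulrA
  [P`_(n - 2 * j) * _]mulrC h2; ring.
Qed.

(** The sum has leading coefficient 1 and satisfies [appell_coefs], which characterises
    [appell k n]. *)
Lemma appell_expansion k n : appell k n =
  \sum_(0 <= j < n./2.+1) (n`!%:R / (j`!%:R * (n - 2 * j)`!%:R) * k ^+ j)
    *: 'X^(n - 2 * j).
Proof.
set S := \sum_(_ <= _ < _) _.
have coefS i : S`_i = \sum_(0 <= j < n./2.+1)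
    (n`!%:R / (j`!%:R * (n - 2 * j)`!%:R) * k ^+ j) * (i == (n - 2 * j)%N)%:R.
  by rewrite /S coef_sum; apply: eq_bigr => j _; rewrite coefZ coefXn.
have half j : (j < n./2.+1)%N = (2 * j <= n)%N.
  by rewrite ltnS mul2n geq_half_double.
have coefS_even j : (2 * j <= n)%N -> S`_(n - 2 * j) =
    n`!%:R / (j`!%:R * (n - 2 * j)`!%:R) * k ^+ j.
  move=> jn; rewrite coefS big_mkord (bigD1 (Ordinal (etrans (half j) jn)))//=.
  rewrite eqxx mulr1 big1 ?addr0// => l lj.
  rewrite (_ : (_ == _) = false) ?mulr0//; apply/negbTE; apply: contraNneq lj => e.
  by apply/eqP/val_inj => /=; have := ltn_ord l; rewrite half; lia.
have Sn : S`_n = 1.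
  have := coefS_even 0%N (leq0n _); rewrite muln0 subn0 => ->.
  by rewrite mul1r mulr1 divff// pnatr_eq0 gtn_eqF ?fact_gt0.
suff h : S = S`_n *: appell k n by rewrite [RHS]h Sn scale1r.
apply/(appell_coefsP k).
  apply/leq_sizeP => i ni; rewrite coefS big1_seq// => j _.
  by rewrite (_ : (i == _) = false) ?mulr0//; lia.
split=> j jn.
  rewrite coefS big_nat big1// => l; rewrite half => /andP[_ ln].
  by rewrite (_ : (_ == _) = false) ?mulr0//; lia.
rewrite coefS_even// Sn; field.
by rewrite !pnatr_eq0 !gtn_eqF ?fact_gt0.
Qed.

End AppellExpansion.

(** Carries Hermite polynomials from [R], where the iterated derivative is computed, to [R[i]]. *)
Lemma map_appell (F K : numFieldType) (f : {rmorphism F -> K}) k n :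
  map_poly f (appell k n) = appell (f k) n.
Proof.
elim: n => [|n IH]; first by rewrite /= rmorph1.
rewrite !appellS rmorphD rmorphM /= map_polyX map_polyZ -deriv_map IH.
by rewrite rmorphM rmorph_nat.
Qed.

(** * The recursion of (a) and the Hermite polynomials *)

Section HermitePolynomials.
Variable R : realType.

(** One step sends [p] to [2 (X p + 2 k p')] with [4 k = - 1 / delta], hence the factor [2^n]. As
    [0^-1 = 0], this also holds for [delta = 0]. *)
Lemma herm_rec_appell (delta C : R[i]) n :
  herm_rec delta C n = (C * 2 ^+ n) *: appell (- (4 * delta)^-1) n.
Proof.
elim: n => [|n IH]; first by rewrite /= expr0 mulr1 -mul_polyC mulr1.
rewrite appellS [LHS]/= IH derivZ invfM -scalerAr scalerDr !scalerA.
have -> : C * 2 ^+ n.+1 = 2 * (C * 2 ^+ n) by rewrite exprS; ring.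
set u := C * _; set d := delta^-1.
have -> : 2 * u * (2 * - (4^-1 * d)) = - (d * u).
  have h4 : 4 * 4^-1 = 1 :> R[i] by rewrite divff// pnatr_eq0.
  by transitivity (- (4 * 4^-1) * (d * u)); [ring|rewrite h4; ring].
by rewrite scaleNr.
Qed.

(** [(p exp (- x^2))' = - 2 (x p - p' / 2) exp (- x^2)]: one step of [appell] with [2 k = - 1 / 2],
    times [- 2]. *)
Lemma derive1n_gauss n (x : R) :
  derive1n n (fun t : R => expR (- t ^+ 2)) x =
  (-1) ^+ n * ((2 ^+ n *: appell (- 4^-1) n).[x] * expR (- x ^+ 2)).
Proof.
elim: n x => [|n IH] x; first by rewrite /= scale1r hornerC !mul1r.
rewrite [LHS]/= -/(derive1n n _) (funext IH) derive1E.
have dg : is_derive x 1 (fun t : R => expR (- t ^+ 2)) (- (2 * x) * expR (- x ^+ 2)).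
  have dq : is_derive x 1 (fun t : R => - t ^+ 2) (- (2 * x)).
    by apply: is_derive_eq; rewrite /GRing.scale /=; ring.
  apply: is_derive_eq (is_derive1_comp (is_derive_expR _) dq) _.
  by rewrite mulrC.
have dp := is_derive_poly (2 ^+ n *: appell (- 4^-1) n) x.
have dpg := is_deriveM dp dg.
have dc := is_deriveZ ((-1) ^+ n) dpg.
rewrite [LHS](@derive_val _ _ _ _ _ _ _ dc).
rewrite appellS derivZ !hornerE /GRing.scale /= !exprS.
by field.
Qed.

Lemma hermiteH_appell n (x : R) :
  (hermiteH n x)%:C = (2 ^+ n *: appell (- (4 : R[i])^-1) n).[x%:C].
Proof.
rewrite /hermiteH derive1n_gauss.
have -> : - (4 : R[i])^-1 = (- 4^-1)%:C by rewrite rmorphN fmorphV rmorph_nat.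
rewrite -(map_appell (real_complex R)) [RHS]hornerZ.
rewrite [(map_poly _ _).[_]]horner_map.
have -> : 2 ^+ n = (2 ^+ n)%:C :> R[i] by rewrite rmorphXn rmorph_nat.
rewrite -rmorphM; congr (_%:C).
transitivity (((-1) ^+ n * (-1) ^+ n) * (expR (x ^+ 2) * expR (- x ^+ 2)) *
  (2 ^+ n *: appell (- 4^-1) n).[x]); first by ring.
by rewrite -expRD subrr expR0 -exprMn mulrNN !mulr1 expr1n mul1r hornerZ.
Qed.

End HermitePolynomials.

(** * From integrals to the heat operator, and the equivalences *)

(** For [P = Q X + c], [gauss_momentXM] and [heatXM] are the same recursion. It involves [Q']
    besides [Q], so the induction is on a bound for the size. *)
Lemma gauss_moment_heat (R : realType) (mu w : R[i]) (P : {poly R[i]}) :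
  0 < complex.Re mu ->
  gauss_moment mu w P = gauss_moment mu w 1 * (heat (4 * mu)^-1 P).[w].
Proof.
move=> mu0; have [m sP] := ubnP (size P); elim: m P sP => // m IH P.
have [->|P0] := eqVneq P 0.
  move=> _; rewrite linear0 horner0 mulr0.
  by rewrite -[X in gauss_moment _ _ X](scale0r (0 : {poly R[i]})) gauss_momentZ// mul0r.
elim/poly_ind: P P0 => [|Q c _]; first by rewrite eqxx.
rewrite size_MXaddC => QX; case: ifP => [/andP[/eqP Q0 /eqP c0]|_].
  by rewrite Q0 c0 mul0r add0r eqxx in QX.
rewrite !ltnS => sQ.
have sQ' : (size Q^`() < m)%N.
  apply: leq_ltn_trans _ sQ; apply/leq_sizeP => j Qj.
  by rewrite coef_deriv nth_default ?mul0rn// leqW.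
have heatC : heat (4 * mu)^-1 c%:P = c%:P.
  by rewrite -[c%:P]mulr1 mul_polyC linearZ /= -(expr0 'X) heatXn.
rewrite mulrC gauss_momentD// gauss_momentXM// (IH Q)// (IH Q^`())//.
rewrite -[c%:P]mulr1 mul_polyC gauss_momentZ//.
rewrite -[c *: 1]mul_polyC mulr1 linearD /= heatXM heat_deriv heatC.
rewrite hornerD hornerC hornerD hornerM hornerX hornerZ.
rewrite (_ : (2 * mu)^-1 = 2 * (4 * mu)^-1); first by ring.
rewrite !invfM mulrA; congr (_ * _).
have h2 : 2 != 0 :> R[i] by rewrite pnatr_eq0.
apply: (mulfI h2); rewrite divff// mulrA -natrM divff// pnatr_eq0//.
Qed.


Theorem theorem3p3 (R : realType) (mu nu a b : R[i]) (n : nat) (P : {poly R[i]}) :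
  a != 0 -> b != 0 -> 0 < complex.Re mu -> 0 < complex.Re nu ->
  nu * b ^+ 2 != mu * a ^+ 2 ->
  (* P = c_0 x^n + c_1 x^(n-1) + ... + c_n with c_0 <> 0 *)
  size P = n.+1 ->
  (forall k : nat, (1 <= k <= n)%N -> a ^+ k != b ^+ k) ->
  let delta := (b ^+ 2 - a ^+ 2) * mu * nu / (nu * b ^+ 2 - mu * a ^+ 2) in
  let c := fun j : nat => P`_(n - j) in
  let intId := fun Cn : R[i] => forall z : R[i],
      Cint (fun x : R => P.[x%:C] * Cexp (- mu * (x%:C - a * z) ^+ 2))
      = Cn * Cint (fun x : R => P.[x%:C] * Cexp (- nu * (x%:C - b * z) ^+ 2)) in
  let condA := exists C : R[i], C != 0 /\ P = herm_rec delta C n in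
  let condB := exists Cn : R[i], intId Cn in
  let condC :=
    (forall k : nat, (2 * k + 1 <= n)%N -> c (2 * k + 1)%N = 0) /\
    (forall k : nat, (2 * k + 2 <= n)%N ->
       (n - 2 * k)`!%:R * c (2 * k)%N
       = - 2%:R * delta * (2 * k + 2)%:R * (n - 2 * k - 2)`!%:R * c (2 * k + 2)%N) in
  [/\ condA <-> condB,
      condB <-> condC,
      (forall Cn : R[i], intId Cn -> Cn = sqrtc nu / sqrtc mu * (a / b) ^+ n),
      (condA ->
         c 0%N / 2%:R ^+ n != 0 /\
         P = (c 0%N / 2%:R ^+ n) *:
             \sum_(0 <= k < n./2.+1)
               (((-1) ^+ k * 2%:R ^+ n * n`!%:R)
                / (4%:R ^+ k * k`!%:R * (n - 2 * k)`!%:R * delta ^+ k))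
               *: 'X^(n - 2 * k))
    & delta = 1 ->
      (condA <-> exists K : R[i], K != 0 /\
                   forall x : R, P.[x%:C] = K * (hermiteH n x)%:C)].
Proof.
move=> a0 b0 Rmu Rnu munu sP ab delta c intId condA condB condC.
(* [delta] may vanish, and then [k = 0], but only when [n <= 1]; in that case
   [appell k n] is ['X^n] whatever [k] is. *)
pose k := - (4 * delta)^-1.
have mu0 : mu != 0 by apply/eqP => mu0; move: Rmu; rewrite mu0 ltxx.
have nu0 : nu != 0 by apply/eqP => nu0; move: Rnu; rewrite nu0 ltxx.
have four0 : 4 != 0 :> R[i] by rewrite pnatr_eq0.
have ab2 : (1 < n)%N -> b ^+ 2 - a ^+ 2 != 0.
  by move=> n1; rewrite subr_eq0 eq_sym ab.
have den0 : nu * b ^+ 2 - mu * a ^+ 2 != 0 by rewrite subr_eq0.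
have delta0 : (1 < n)%N -> delta != 0.
  by move=> /ab2 h; rewrite /delta !mulf_neq0 ?invr_eq0.
(* An equation linear in [k] with coefficient [b^2 - a^2]; solving it is what produces the formula
   for [delta]. *)
have hk : (1 < n)%N ->
    (k + (4 * mu)^-1) * b ^+ 2 = (k + (4 * nu)^-1) * a ^+ 2.
  by move=> /ab2 h; rewrite /k /delta; field; do ?[apply/andP; split].
have kdelta : (1 < n)%N -> - 4 * delta * k = 1.
  by move=> /delta0 h; rewrite /k; field.
have Pn0 : P`_n != 0.
  by rewrite -[n]/n.+1.-1 -sP -/(lead_coef P) lead_coef_eq0 -size_poly_eq0 sP.
have two0 : (2 : R[i]) ^+ n != 0 by rewrite expf_neq0 ?pnatr_eq0.
have smu0 : sqrtc mu != 0 by rewrite sqrtc_eq0.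
have snu0 : sqrtc nu != 0 by rewrite sqrtc_eq0.
have pi0 : (Num.sqrt pi : R)%:C != 0.
  by rewrite fmorph_eq0 gt_eqF// sqrtr_gt0 pi_gt0.
have intE m w : 0 < complex.Re m ->
    Cint (fun x : R => P.[x%:C] * Cexp (- m * (x%:C - w) ^+ 2)) =
    (Num.sqrt pi)%:C / sqrtc m * (heat (4 * m)^-1 P).[w].
  move=> Rm; rewrite -/(gauss_moment m w P) gauss_moment_heat//; congr (_ * _).
  have sm0 : sqrtc m != 0.
    by rewrite sqrtc_eq0; apply/eqP => m0; move: Rm; rewrite m0 ltxx.
  by apply: (mulfI sm0); rewrite gauss_moment1// mulrCA divff// mulr1.
(* The prefactors [sqrt pi / sqrt mu] and [sqrt pi / sqrt nu] turn [Cn] into [Cn sqrt mu / sqrt nu],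
   hence the ratio of roots in the final constant. *)
have intIdE Cn : intId Cn <-> heat_proportional (4 * mu)^-1 (4 * nu)^-1 a b
    (Cn * (sqrtc mu / sqrtc nu)) P.
  have scal z : (Cint (fun x : R => P.[x%:C] * Cexp (- mu * (x%:C - a * z) ^+ 2)) =
      Cn * Cint (fun x : R => P.[x%:C] * Cexp (- nu * (x%:C - b * z) ^+ 2))) <->
      ((heat (4 * mu)^-1 P).[a * z] =
         Cn * (sqrtc mu / sqrtc nu) * (heat (4 * nu)^-1 P).[b * z]).
    rewrite !intE//; set A := _.[_]; set B := _.[_].
    split=> [h|->]; last by field; apply/andP.
    have f0 : (Num.sqrt pi)%:C / sqrtc mu != 0 by rewrite mulf_neq0 ?invr_eq0.
    by apply: (mulfI f0); rewrite h; field; apply/andP.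
  split=> [h|h z].
    (* The values at natural [z] already determine the polynomial identity. *)
    apply: poly_eq_nat => j; rewrite hornerZ !horner_comp !hornerZ !hornerX.
    exact: (scal j%:R).1.
  apply/(scal z); move: h => /(congr1 (horner^~ z)).
  by rewrite hornerZ !horner_comp !hornerZ !hornerX.
have condAE : condA <-> P = P`_n *: appell k n.
  split=> [[C [C0 PE]]|PE].
    rewrite herm_rec_appell -/k in PE.
    by rewrite {1 2}PE coefZ coef_appell_top mulr1.
  exists (P`_n / 2 ^+ n); split; first by rewrite mulf_neq0 ?invr_eq0.
  by rewrite herm_rec_appell divfK.
have condBE : condB <-> P = P`_n *: appell k n.
  rewrite -(heat_proportionalE a0 b0 ab sP hk); split=> [[Cn /intIdE]|[C h]].
    by exists (Cn * (sqrtc mu / sqrtc nu)).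
  exists (C * (sqrtc nu / sqrtc mu)); apply/intIdE.
  have -> : C * (sqrtc nu / sqrtc mu) * (sqrtc mu / sqrtc nu) = C.
    by field; apply/andP.
  exact: h.
have condCE : condC <-> P = P`_n *: appell k n.
  have sP' : (size P <= n.+1)%N by rewrite sP.
  by rewrite -(appell_coefsP k sP'); rewrite (appell_coefs_rec P kdelta).
split.
- by rewrite condAE condBE.
- by rewrite condBE condCE.
- move=> Cn /intIdE /(heat_proportional_factor a0 b0 sP) <-.
  by field; apply/andP.
- move=> /condAE PE; rewrite /c subn0; split; first by rewrite mulf_neq0 ?invr_eq0.
  rewrite {1}PE appell_expansion !scaler_sumr; apply: eq_bigr => j _.
  rewrite !scalerA; congr (_ *: _).
  have f0 i : i`!%:R != 0 :> R[i] by rewrite pnatr_eq0 gtn_eqF ?fact_gt0.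
  have -> : k ^+ j = (-1) ^+ j * ((4 ^+ j)^-1 * (delta ^+ j)^-1).
    rewrite /k (exprNn (4 * delta)^-1) (exprVn (4 * delta)) exprMn.
    by rewrite invfM.
  (* The inverse power is abstracted so that [field] does not ask for [delta != 0], which may fail
     when [n <= 1]. *)
  rewrite !invfM; move: (delta ^+ j)^-1 => d; field.
  by rewrite !f0 two0 expf_neq0.
- move=> delta1; have kE : k = - 4^-1 by rewrite /k delta1 mulr1.
  rewrite condAE kE; split=> [PE|[K [K0 PH]]].
    exists (P`_n / 2 ^+ n); split; first by rewrite mulf_neq0 ?invr_eq0.
    by move=> x; rewrite hermiteH_appell {1}PE !hornerZ mulrA divfK.
  have PE : P = (K * 2 ^+ n) *: appell (- 4^-1) n.
    (* The identity is given at real arguments only, and the naturals are among them. *)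
    apply: poly_eq_nat => j; rewrite -(rmorph_nat (real_complex R)) PH.
    by rewrite hermiteH_appell !hornerZ mulrA.
  by rewrite {1 2}PE coefZ coef_appell_top mulr1.
Qed.
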